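(* Consider a planar spider mechanism whose spider space $\mathcal{S}$ is smooth, let $Z\in\mathbb{R}^2$ be a fixed point, and let $\mathbb{D}:\mathcal{S}\to\mathbb{R}$, $\mathbb{D}(\xi)=\|\pi(\xi)-z\|^2$. Let $\xi\in\mathcal{S}$ be a configuration with body $X=\pi(\xi)$, satisfying condition $(\star)$: for every leg $i$ that is aligned in $\xi$, no two of the points $A_i$, $X$, $Z$ coincide. Then $\xi$ is critical for $\mathbb{D}$ if and only if it satisfies at least one of the following conditions: (1) $X=Z$; (2) one leg is aligned, and the point $Z$ lies on the line containing this leg; (3) two different legs are aligned.
   Context: Points of $\mathbb{R}^2$ are denoted by capital letters and the corresponding vectors by lower-case letters. An $n$-legged planar spider mechanism consists of pairwise distinct fixed points (feet) $A_1,\dots,A_n\in\mathbb{R}^2$, integers $p_1,\dots,p_n>1$, and lengths $\ell_{i,j}>0$ ($1\le i\le n$, $1\le j\le p_i$). A configuration (spider) $\xi$ consists of a point $X\in\mathbb{R}^2$ (the body) and joints $A_i^1,\dots,A_i^{p_i-1}\in\mathbb{R}^2$ for each $i$ such that, with $A_i^0=A_i$ and $A_i^{p_i}=X$, one has $|A_i^{j-1}A_i^{j}|=\ell_{i,j}$ for all $i$ and $1\le j\le p_i$. The $i$-th leg of $\xi$ is the chain $A_i^0,\dots,A_i^{p_i}$; it is aligned if all these points lie on one straight line. The spider space $\mathcal{S}\subset(\mathbb{R}^2)^{1+\sum_i(p_i-1)}$ is the set of all configurations, and the work map $\pi:\mathcal{S}\to\mathbb{R}^2$ sends $\xi$ to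 its body $X$. The spider space is called smooth if no configuration has two aligned legs lying in one and the same straight line, and no configuration has three aligned legs; then $\mathcal{S}$ is a smooth compact manifold of dimension $2-2n+\sum_i p_i$. *)

(* Defs.v *)
From mathcomp Require Import all_boot all_order all_algebra.
From mathcomp Require Import all_classical all_reals all_analysis.

Set Implicit Arguments.
Unset Strict Implicit.
Unset Printing Implicit Defensive.

Import Order.TTheory GRing.Theory Num.Theory.
Import numFieldNormedType.Exports.

Local Open Scope classical_set_scope.
Local Open Scope ring_scope.

(* The library norm `|u| on 'rV[R]_2 is the sup norm, so the Euclidean norm is
   defined separately. *)
Definition enorm (R : realType) (u : 'rV[R]_2) : R :=
  Num.sqrt (\sum_(c < 2) u 0 c ^+ 2).

Definition is_line (R : realType) (L : set 'rV[R]_2) : Prop :=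
  exists a u : 'rV[R]_2, u != 0 /\ L = [set a + t *: u | t in [set: R]].

(* link_length j, where j : 'I_(nlinks i) is counted from 0, is the prescribed
   distance between the vertices number j and j + 1 of leg i. *)
Record mechanism (R : realType) (n : nat) := Mechanism {
  foot : 'I_n -> 'rV[R]_2;
  foot_inj : injective foot;
  nlinks : 'I_n -> nat;
  nlinks_gt1 : forall i, (1 < nlinks i)%N;
  link_length : forall i, 'I_(nlinks i) -> R;
  link_length_gt0 : forall i (j : 'I_(nlinks i)), 0 < link_length j
}.

(* A point of the ambient space (R^2)^(1 + \sum_i (p_i - 1)); in leg i, the
   joint with index j, counted from 0, is the vertex number j + 1. *)
Record config (R : realType) (n : nat) (M : mechanism R n) := Config {
  body : 'rV[R]_2;
  joint : forall i : 'I_n, 'I_(nlinks M i).-1 -> 'rV[R]_2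
}.

(* The foot for j = 0, a joint for 0 < j < p_i, and the body for j = p_i (and,
   irrelevantly, for every larger j). *)
Definition vertex (R : realType) (n : nat) (M : mechanism R n)
    (xi : config M) (i : 'I_n) (j : nat) : 'rV[R]_2 :=
  if j is j'.+1 then
    if insub j' is Some k then joint xi (i := i) k else body xi
  else foot M i.

Definition spider_space (R : realType) (n : nat) (M : mechanism R n) :
    set (config M) :=
  [set xi | forall (i : 'I_n) (j : 'I_(nlinks M i)),
     enorm (vertex xi i j.+1 - vertex xi i j) = link_length j].

Definition leg_on (R : realType) (n : nat) (M : mechanism R n)
    (xi : config M) (i : 'I_n) (L : set 'rV[R]_2) : Prop :=
  is_line L /\ forall j : nat, (j <= nlinks M i)%N -> L (vertex xi i j).

Definition aligned (R : realType) (n : nat) (M : mechanism R n)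
    (xi : config M) (i : 'I_n) : Prop :=
  exists L, leg_on xi i L.

Definition smooth_spider_space (R : realType) (n : nat) (M : mechanism R n) :
    Prop :=
  forall xi : config M, spider_space xi ->
    (~ exists (i k : 'I_n) (L : set 'rV[R]_2),
         [/\ i != k, leg_on xi i L & leg_on xi k L]) /\
    (~ exists i k l : 'I_n,
         [/\ i != k, i != l & k != l] /\
         [/\ aligned xi i, aligned xi k & aligned xi l]).

Definition smooth_on (R : realType) (e : R) (f : R -> R) : Prop :=
  forall (m : nat) (t : R), `|t| < e -> derivable (derive1n m f) t 1.

(* Only the restriction of g to the open interval `]-e, e[ matters. *)
Definition smooth_curve_through (R : realType) (n : nat) (M : mechanism R n)
    (xi : config M) (g : R -> config M) : Prop :=
  g 0 = xi /\
  exists2 e : R, 0 < e &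
    [/\ forall t : R, `|t| < e -> spider_space (g t),
        forall c : 'I_2, smooth_on e (fun t => body (g t) 0 c) &
        forall (i : 'I_n) (j : 'I_(nlinks M i).-1) (c : 'I_2),
          smooth_on e (fun t => joint (g t) j 0 c)].

(* The differential of F at xi vanishes on the tangent space of the spider
   space, the tangent vectors being the velocities of the smooth curves in the
   spider space through xi. *)
Definition critical (R : realType) (n : nat) (M : mechanism R n)
    (F : config M -> R) (xi : config M) : Prop :=
  spider_space xi /\
  forall g : R -> config M, smooth_curve_through xi g ->
    is_derive (0 : R) (1 : R) (F \o g) 0.

Definition sq_dist_to (R : realType) (n : nat) (M : mechanism R n)
    (Z : 'rV[R]_2) (xi : config M) : R :=
  enorm (body xi - Z) ^+ 2.

(* Main.v *)
(* Along a smooth curve in the spider space, the body velocity is orthogonal to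
   every aligned leg. Hence it is orthogonal to X - Z in case (2), and it is 0 in
   case (3), where the two aligned legs are transverse by smoothness.

   Conversely, the end of a non-aligned leg can be moved along any prescribed
   short smooth curve: two consecutive links are not parallel, so one can keep
   the vertices before their common joint fixed, translate those after it, and
   recover the joint as an intersection of two circles. If no leg is aligned, X
   can therefore move with velocity X - Z; if only leg i is aligned, that leg can
   rotate rigidly about A_i and carry all the others along. In the first case
   criticality forces X = Z, in the second that Z lies on the line A_i X. *)
Require Import Defs.
From mathcomp Require Import all_boot all_order all_algebra.
From mathcomp Require Import all_classical all_reals all_analysis.
From mathcomp Require Import ring.

Set Implicit Arguments.
Unset Strict Implicit.
Unset Printing Implicit Defensive.

Import Order.TTheory GRing.Theory Num.Theory.
Import numFieldNormedType.Exports.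

Local Open Scope classical_set_scope.
Local Open Scope ring_scope.

(** * Smooth functions on an interval *)

Section SmoothOn.
Variable R : realType.
Implicit Types (e t : R) (f g : R -> R).

Lemma near_norm_lt e t : `|t| < e -> \forall s \near t, `|s| < e.
Proof.
move=> te; apply/nbhs_ballP; exists (e - `|t|); first by rewrite /= subr_gt0.
move=> s /=; rewrite /ball /= distrC => st.
by rewrite -[s](subrK t) (le_lt_trans (ler_normD _ _))// -ltrBrDr.
Qed.

(** A coinduction principle: if a class is closed under differentiation on the interval, induction
    on [m] finds in it a function that agrees there with the [m]-th derivative of [f]. Agreement on
    the open interval suffices, since derivatives are local. *)
Lemma smooth_on_coind e (S : (R -> R) -> Prop) :
    (forall f, S f ->
       exists2 g, S g & forall t, `|t| < e -> is_derive t 1 f (g t)) ->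
  forall f, S f -> smooth_on e f.
Proof.
move=> Sder f Sf m.
have [g Sg fg] : exists2 g, S g & forall t, `|t| < e -> derive1n m f t = g t.
  elim: m => [|m [g Sg fg]]; first by exists f.
  have [h Sh gh] := Sder g Sg; exists h => // t te.
  rewrite derive1nS derive1E; have gh_t := gh t te.
  rewrite -(@derive_val _ _ _ _ _ _ _ gh_t); apply: near_eq_derive.
  by near=> s; apply: fg; near: s; exact: near_norm_lt.
move=> t te; have [h _ /(_ t te) gh] := Sder g Sg.
apply: near_eq_derivable (@ex_derive _ _ _ _ _ _ _ gh).
by near=> s; apply/esym/fg; near: s; exact: near_norm_lt.
Unshelve. all: by end_near.
Qed.

Lemma smooth_on_derive1 e f : smooth_on e f -> smooth_on e (derive1 f).
Proof. by move=> fS m; rewrite -derive1Sn; exact: fS. Qed.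

Lemma smooth_on_is_derive e f t :
  smooth_on e f -> `|t| < e -> is_derive t 1 f (derive1 f t).
Proof. by move=> fS te; rewrite derive1E; apply: derivableP; exact: (fS 0%N). Qed.

Lemma smooth_on_continuous e f t :
  smooth_on e f -> `|t| < e -> {for t, continuous f}.
Proof.
by move=> fS te; apply/differentiable_continuous/derivable1_diffP/(fS 0%N).
Qed.

Lemma smooth_onW e e' f : e' <= e -> smooth_on e f -> smooth_on e' f.
Proof. by move=> ee' fS m t te; apply: fS; exact: lt_le_trans ee'. Qed.

Lemma smooth_on_gt0 e f : 0 < e -> smooth_on e f -> 0 < f 0 ->
  exists2 e', 0 < e' <= e & forall t, `|t| < e' -> 0 < f t.
Proof.
move=> e0 fS f0.
have fc : {for 0, continuous f} by apply: smooth_on_continuous fS _; rewrite normr0.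
have /nbhs_ballP[d /= d0 df] : \forall t \near (0 : R), 0 < f t.
  exact: (fc _ (lt_nbhsr f0)).
exists (Num.min d e); first by rewrite lt_min d0 e0 ge_min lexx orbT.
by move=> t; rewrite lt_min => /andP[td _]; apply: df; rewrite /ball /= sub0r normrN.
Qed.

(* Derivatives of sums, products and powers of functions of the class stay in
   the class, which makes it an invariant for [smooth_on_coind]. *)
Inductive smooth_expr e : (R -> R) -> Prop :=
| SmoothBase f : smooth_on e f -> smooth_expr e f
| SmoothCst a : smooth_expr e (fun=> a)
| SmoothAdd f g :
    smooth_expr e f -> smooth_expr e g -> smooth_expr e (fun t => f t + g t)
| SmoothMul f g :
    smooth_expr e f -> smooth_expr e g -> smooth_expr e (fun t => f t * g t)
| SmoothPow a f :
    (forall t, `|t| < e -> 0 < f t) -> smooth_expr e f ->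
    smooth_expr e (fun t => f t `^ a).

Lemma smooth_expr_smooth e f : smooth_expr e f -> smooth_on e f.
Proof.
move: f; apply: smooth_on_coind => f; elim=> {f}.
- move=> f fS; exists (derive1 f).
    by apply: SmoothBase; exact: smooth_on_derive1.
  by move=> t; exact: smooth_on_is_derive.
- move=> a; exists (fun=> 0); first exact: SmoothCst.
  by move=> t te; exact: is_derive_cst.
- move=> f g _ [f' Ef' ff'] _ [g' Eg' gg'].
  exists (fun t => f' t + g' t); first exact: SmoothAdd.
  by move=> t te; apply: (is_deriveD (ff' t te) (gg' t te)).
- move=> f g Ef [f' Ef' ff'] Eg [g' Eg' gg'].
  exists (fun t => f t * g' t + g t * f' t).
    by apply: SmoothAdd; exact: SmoothMul.
  by move=> t te; apply: (is_deriveM (ff' t te) (gg' t te)).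
- move=> a f f0 Ef [f' Ef' ff'].
  exists (fun t => (a * f t `^ (a - 1)) * f' t).
    apply: (SmoothMul (f := fun t => a * f t `^ (a - 1))) => //.
    apply: (SmoothMul (f := fun=> a) (SmoothCst e a)).
    exact: SmoothPow.
  move=> t te.
  exact: (is_derive1_comp (is_derive1_powR a (f0 t te)) (ff' t te)).
Qed.

Lemma smooth_on_cst e (a : R) : smooth_on e (fun=> a).
Proof. by apply: smooth_expr_smooth; exact: SmoothCst. Qed.

Lemma smooth_onD e f g :
  smooth_on e f -> smooth_on e g -> smooth_on e (fun t => f t + g t).
Proof.
by move=> fS gS; apply: smooth_expr_smooth; apply: SmoothAdd; exact: SmoothBase.
Qed.

Lemma smooth_onM e f g :
  smooth_on e f -> smooth_on e g -> smooth_on e (fun t => f t * g t).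
Proof.
by move=> fS gS; apply: smooth_expr_smooth; apply: SmoothMul; exact: SmoothBase.
Qed.

Lemma smooth_onN e f : smooth_on e f -> smooth_on e (fun t => - f t).
Proof.
move=> fS; rewrite (_ : (fun t => _) = (fun t => -1 * f t)).
  by apply: (smooth_onM (f := fun=> -1)) fS; exact: smooth_on_cst.
by apply/funext => t; rewrite mulN1r.
Qed.

Lemma smooth_onB e f g :
  smooth_on e f -> smooth_on e g -> smooth_on e (fun t => f t - g t).
Proof. by move=> fS gS; apply: smooth_onD fS (smooth_onN gS). Qed.

Lemma smooth_on_powR e a f :
    (forall t, `|t| < e -> 0 < f t) -> smooth_on e f ->
  smooth_on e (fun t => f t `^ a).
Proof.
by move=> f0 fS; apply: smooth_expr_smooth; apply: SmoothPow => //; exact: SmoothBase.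
Qed.

Lemma smooth_on_id e : smooth_on e id.
Proof.
(* The identity together with the constants is closed under differentiation. *)
apply: (@smooth_on_coind e (fun f => f = id \/ exists a, f = fun=> a)); last by left.
move=> f [->|[a ->]].
  exists (fun=> 1); first by right; exists 1.
  by move=> t _; exact: is_derive_id.
exists (fun=> 0); first by right; exists 0.
by move=> t _; exact: is_derive_cst.
Qed.

Lemma smooth_on_trig e (a b : R) : smooth_on e (fun t => a * cos t + b * sin t).
Proof.
apply: (@smooth_on_coind e (fun f => exists a b, f = fun t => a * cos t + b * sin t));
  last by exists a, b.
move=> _ [{}a [{}b ->]]; exists (fun t => b * cos t + - a * sin t); first by exists b, (- a).
move=> t _.
have Dcos := is_deriveZ a (is_derive_cos t).
have Dsin := is_deriveZ b (is_derive_sin t).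
apply: is_derive_eq (is_deriveD Dcos Dsin) _.
by rewrite /GRing.scale /=; ring.
Qed.

End SmoothOn.

(** * Plane geometry *)

Section Plane.
Variable R : realType.
Implicit Types (u v w : 'rV[R]_2).

Definition dot u v : R := u 0 0 * v 0 0 + u 0 1 * v 0 1.

Definition cross u v : R := u 0 0 * v 0 1 - u 0 1 * v 0 0.

Definition vec2 (x y : R) : 'rV[R]_2 := \row_c (if c == 0 then x else y).

Lemma vec2_0 x y : vec2 x y 0 0 = x. Proof. by rewrite mxE. Qed.

Lemma vec2_1 x y : vec2 x y 0 1 = y. Proof. by rewrite mxE. Qed.

Lemma row2P u v : u 0 0 = v 0 0 -> u 0 1 = v 0 1 -> u = v.
Proof.
move=> e0 e1; apply/rowP => -[[|[|//]] lt_c2].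
  by rewrite (_ : Ordinal _ = 0) //; exact: val_inj.
by rewrite (_ : Ordinal _ = 1) //; exact: val_inj.
Qed.

Lemma smooth_on_coord e (f : R -> 'rV[R]_2) :
    smooth_on e (fun t => f t 0 0) -> smooth_on e (fun t => f t 0 1) ->
  forall c, smooth_on e (fun t => f t 0 c).
Proof.
move=> f0 f1 [[|[|//]] lt_c2].
  by rewrite (_ : Ordinal _ = 0) //; exact: val_inj.
by rewrite (_ : Ordinal _ = 1) //; exact: val_inj.
Qed.

Lemma enorm_sqr u : enorm u ^+ 2 = dot u u.
Proof.
rewrite /enorm sqr_sqrtr; last by apply: sumr_ge0 => c _; exact: sqr_ge0.
by rewrite big_ord_recl big_ord1 /dot !expr2 (_ : lift _ _ = 1) //; exact: val_inj.
Qed.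

Lemma enorm_ge0 u : 0 <= enorm u. Proof. exact: sqrtr_ge0. Qed.

Lemma eq_enorm u v : dot u u = dot v v -> enorm u = enorm v.
Proof.
rewrite -!enorm_sqr => uv.
by apply/eqP; rewrite -(eqrXn2 (n := 2)) ?enorm_ge0 //; apply/eqP.
Qed.

Lemma dot_gt0 u : u != 0 -> 0 < dot u u.
Proof.
move=> u0; rewrite lt0r -enorm_sqr sqr_ge0 andbT enorm_sqr.
apply: contra u0; rewrite /dot -!expr2 paddr_eq0 ?sqr_ge0 //.
by rewrite !sqrf_eq0 => /andP[/eqP u0 /eqP u1]; apply/eqP/row2P; rewrite mxE.
Qed.

Lemma enorm0 : enorm (0 : 'rV[R]_2) = 0.
Proof. by apply/eqP; rewrite -sqrf_eq0 enorm_sqr /dot !mxE mulr0 addr0. Qed.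

Lemma cross_eq0_colinear u v : u != 0 -> cross u v = 0 -> exists a, v = a *: u.
Proof.
(* The coefficient is that of the orthogonal projection of [v] on [u]; the remainder is a multiple
   of [cross u v]. *)
move=> /dot_gt0/gt_eqF/negbT uu uv; exists (dot u v / dot u u).
have uu' : u 0 0 * u 0 0 + u 0 1 * u 0 1 != 0 by [].
apply: row2P; rewrite mxE.
  transitivity (dot u v / dot u u * u 0 0 - u 0 1 * cross u v / dot u u).
    by rewrite /dot /cross; field.
  by rewrite uv mulr0 mul0r subr0.
transitivity (dot u v / dot u u * u 0 1 + u 0 0 * cross u v / dot u u).
  by rewrite /dot /cross; field.
by rewrite uv mulr0 mul0r addr0.
Qed.

(* The apex over the moving base [0, (x, y)] is [a (x, y) + h (- y, x)]; the
   factor [k] of [h] carries the sign of the orientation of the triangle. *)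
Lemma two_circles (e : R) (x y : R -> R) (b0 b1 : R) :
    0 < e -> smooth_on e x -> smooth_on e y -> x 0 * b1 - y 0 * b0 != 0 ->
  exists2 e', 0 < e' <= e & exists f g : R -> R,
    [/\ f 0 = b0, g 0 = b1, smooth_on e' f, smooth_on e' g &
        forall t, `|t| < e' ->
          f t * f t + g t * g t = b0 * b0 + b1 * b1 /\
          (x t - f t) * (x t - f t) + (y t - g t) * (y t - g t) =
          (x 0 - b0) * (x 0 - b0) + (y 0 - b1) * (y 0 - b1)].
Proof.
move=> e0 xS yS; set k0 := _ - _ => k0_neq0.
pose s t := x t * x t + y t * y t.
have sS : smooth_on e s by apply: smooth_onD; exact: smooth_onM.
have s0 : 0 < s 0.
  rewrite lt0r addr_ge0 -?expr2 ?sqr_ge0 ?andbT //.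
  apply: contra k0_neq0; rewrite /s -!expr2 paddr_eq0 ?sqr_ge0 // !sqrf_eq0.
  by move=> /andP[/eqP x0 /eqP y0]; rewrite /k0 x0 y0 !mul0r subr0.
have [e1 /andP[e1_gt0 e1e] s_gt0] := smooth_on_gt0 e0 sS s0.
pose l1 := b0 * b0 + b1 * b1.
pose l2 := (x 0 - b0) * (x 0 - b0) + (y 0 - b1) * (y 0 - b1).
pose k := k0 / s 0.
(* The inverse of [s] is written as a real power so that [smooth_on_powR] applies. *)
pose i t := s t `^ (-1).
(* Subtracting the two circle equations gives 2 a s = l1 - l2 + s; the first one then gives h^2 = l1
   / s - a^2. *)
pose a t := (l1 - l2 + s t) * i t * 2^-1.
(* [q] is h^2 / k^2, normalized to be 1 at time 0. It stays positive for small times, where its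
   square root is therefore smooth. *)
pose q t := (l1 * i t - a t * a t) * k ^- 2.
pose h t := k * q t `^ 2^-1.
have xS1 := smooth_onW e1e xS; have yS1 := smooth_onW e1e yS.
have iS : smooth_on e1 i by apply: smooth_on_powR => //; exact: smooth_onW sS.
have iE t : `|t| < e1 -> i t = (s t)^-1.
  by move=> te; rewrite /i powR_inv1 // ltW // s_gt0.
have aS : smooth_on e1 a.
  apply: smooth_onM; last exact: smooth_on_cst.
  apply: smooth_onM => //; apply: smooth_onD; first exact: smooth_on_cst.
  exact: smooth_onW sS.
have qS : smooth_on e1 q.
  apply: smooth_onM; last exact: smooth_on_cst.
  apply: smooth_onB.
    by apply: smooth_onM => //; exact: smooth_on_cst.
  exact: smooth_onM.
have e10 : `|0 : R| < e1 by rewrite normr0.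
have s0_neq0 : x 0 * x 0 + y 0 * y 0 != 0 by rewrite gt_eqF.
have k_neq0 : k != 0 by rewrite mulf_neq0 // invr_neq0.
have a0 : a 0 = (x 0 * b0 + y 0 * b1) / s 0.
  by rewrite /a (iE _ e10) /l1 /l2 /s; field.
have q0 : q 0 = 1.
  rewrite /q a0 (iE _ e10) -[RHS](divff (x := k ^+ 2)) ?sqrf_eq0 //; congr (_ * _).
  by rewrite /l1 /k /k0 /s; field.
have [e2 /andP[e2_gt0 e21] q_gt0] : exists2 e2, 0 < e2 <= e1 &
    forall t, `|t| < e2 -> 0 < q t.
  by apply: smooth_on_gt0; rewrite ?q0.
have hS : smooth_on e2 h.
  apply: (smooth_onM (f := fun=> k)); first exact: smooth_on_cst.
  by apply: smooth_on_powR => //; exact: smooth_onW qS.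
have {}aS := smooth_onW e21 aS.
have {}xS1 := smooth_onW e21 xS1; have {}yS1 := smooth_onW e21 yS1.
have h0 : h 0 = k by rewrite /h q0 powR1 mulr1.
have hE t : `|t| < e2 -> h t * h t = l1 / s t - a t * a t.
  move=> te; rewrite -expr2 /h exprMn powR12_sqrt ?ltW ?q_gt0 //.
  rewrite sqr_sqrtr ?ltW ?q_gt0 // /q iE ?(lt_le_trans te) //.
  by field; rewrite k_neq0 gt_eqF // s_gt0 // (lt_le_trans te).
exists e2; first by rewrite e2_gt0 (le_trans e21).
exists (fun t => a t * x t - h t * y t), (fun t => a t * y t + h t * x t); split.
- by rewrite a0 h0 /k /k0 /s; field.
- by rewrite a0 h0 /k /k0 /s; field.
- by apply: smooth_onB; exact: smooth_onM.
- by apply: smooth_onD; exact: smooth_onM.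
move=> t te; have st_neq0 : s t != 0 by rewrite gt_eqF // s_gt0 // (lt_le_trans te).
have fg : (a t * x t - h t * y t) * (a t * x t - h t * y t) +
    (a t * y t + h t * x t) * (a t * y t + h t * x t) = l1.
  transitivity ((a t * a t + h t * h t) * s t); first by rewrite /s; ring.
  by rewrite hE // addrC subrK divfK.
split=> //; rewrite -/l2.
have aE : 2 * a t * s t = l1 - l2 + s t.
  by rewrite /a iE ?(lt_le_trans te) //; field.
transitivity (s t - 2 * a t * s t + l1); last by rewrite aE; ring.
by rewrite -fg /s; ring.
Qed.

Lemma orthogonal_basis u v w :
  cross u v != 0 -> dot u w = 0 -> dot v w = 0 -> w = 0.
Proof.
move=> uv uw vw; apply: row2P; rewrite mxE; apply: (mulfI uv); rewrite mulr0.
  transitivity (v 0 1 * dot u w - u 0 1 * dot v w); first by rewrite /dot /cross; ring.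
  by rewrite uw vw !mulr0 subr0.
transitivity (u 0 0 * dot v w - v 0 0 * dot u w); first by rewrite /dot /cross; ring.
by rewrite uw vw !mulr0 subr0.
Qed.

End Plane.

(** * Motions of a single leg *)

Section LegMotion.
Variable R : realType.
Implicit Types (e : R) (p : nat) (v : nat -> 'rV[R]_2) (X : R -> 'rV[R]_2).

(** Links being nonzero, parallelism passes from each link to the next, so every link is a multiple
    of the first; the multiples add up along the leg. *)
Lemma straight_leg p v : (0 < p)%N ->
    (forall j, (j < p)%N -> v j.+1 - v j != 0) ->
    (forall j, (j.+1 < p)%N -> cross (v j.+1 - v j) (v j.+2 - v j.+1) = 0) ->
  forall j, (j <= p)%N -> exists a, v j = v 0%N + a *: (v 1%N - v 0%N).
Proof.
move=> p0 v_neq0 v_cross; set u := v 1%N - v 0%N.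
have edge j : (j < p)%N -> exists b, v j.+1 - v j = b *: u.
  elim: j => [_|j IH jp]; first by exists 1; rewrite scale1r.
  have [b vjE] := IH (ltnW jp).
  have bu : b *: u != 0 by rewrite -vjE v_neq0 // ltnW.
  have := v_cross _ jp; rewrite vjE => /(cross_eq0_colinear bu)[c ->].
  by exists (c * b); rewrite scalerA.
elim=> [_|j IH jp]; first by exists 0; rewrite scale0r addr0.
have [[a vjE] [b eE]] := (IH (ltnW jp), edge j jp).
by exists (a + b); rewrite -(subrK (v j) (v j.+1)) eE vjE scalerDl addrCA [b *: u + _]addrC.
Qed.

(** The curve [X] of the last vertex is a parameter, so that motions of different legs can be made
    to share the same body. *)
Definition leg_motion e p v X (w : R -> nat -> 'rV[R]_2) : Prop :=
  [/\ forall k, (k <= p)%N -> w 0 k = v k, forall t, w t 0%N = v 0%N, forall t, w t p = X t,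
      forall t, `|t| < e -> forall k, (k < p)%N ->
        enorm (w t k.+1 - w t k) = enorm (v k.+1 - v k) &
      forall k c, smooth_on e (fun t => w t k 0 c)].

Lemma leg_motionW e e' p v X w :
  e' <= e -> leg_motion e p v X w -> leg_motion e' p v X w.
Proof.
move=> ee' [w0 wf wb wl wS]; split=> // [t te k kp|k c]; last exact: smooth_onW (wS k c).
by apply: wl => //; exact: lt_le_trans ee'.
Qed.

(** The bend at vertex j + 1 makes the triangle on the vertices j, j + 1, j + 2 nondegenerate, as
    [two_circles] requires. *)
Lemma fold_leg e p v X j : 0 < e -> (forall c, smooth_on e (fun t => X t 0 c)) ->
    X 0 = v p -> (j.+1 < p)%N ->
    cross (v j.+1 - v j) (v j.+2 - v j.+1) != 0 ->
  exists2 e', 0 < e' <= e & exists w, leg_motion e' p v X w.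
Proof.
move=> e0 XS X0 jp fold.
pose d t := X t - v p.
have dS c : smooth_on e (fun t => d t 0 c).
  rewrite /d (_ : (fun t => _) = (fun t => X t 0 c - v p 0 c)); last first.
    by apply/funext => t; rewrite !mxE.
  by apply: smooth_onB => //; exact: smooth_on_cst.
have d0 : d 0 = 0 by rewrite /d X0 subrr.
(* [D] is the moving base, from the fixed vertex j to the translated vertex j + 2; [b] is the
   initial position of the apex relative to vertex j. *)
pose D t := v j.+2 - v j + d t.
pose b := v j.+1 - v j.
have DS c : smooth_on e (fun t => D t 0 c).
  rewrite /D (_ : (fun t => _) = (fun t => (v j.+2 - v j) 0 c + d t 0 c)); last first.
    by apply/funext => t; rewrite !mxE.
  by apply: smooth_onD => //; exact: smooth_on_cst.
have Db : D 0 0 0 * b 0 1 - D 0 0 1 * b 0 0 != 0.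
  apply: contra fold => /eqP Db0; rewrite -oppr_eq0 -[X in _ == X]Db0; apply/eqP.
  by rewrite /cross /D d0 /b !mxE; ring.
have [e1 e1_le [f [g [f0 g0 fS gS fg]]]] := two_circles e0 (DS 0) (DS 1) Db.
exists e1 => //; have /andP[_ e1e] := e1_le.
exists (fun t k => if (k <= j)%N then v k
                   else if k == j.+1 then v j + vec2 (f t) (g t) else v k + d t).
split=> /=.
- move=> k _; case: leqP => // jk; case: eqP => [->|_]; last by rewrite d0 addr0.
  by apply: row2P; rewrite !mxE /= ?f0 ?g0 /b !mxE addrC subrK.
- by [].
- by move=> t; rewrite leqNgt (ltnW jp) /= gtn_eqF // addrC subrK.
- move=> t te k kp; have [fg1 fg2] := fg t te.
  (* Links before vertex j are fixed and those after vertex j + 2 are translated; only the two links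
     at vertex j + 1 need the circle equations. *)
  have [kj|jk|kj] := ltngtP k j.
  + by [].
  + rewrite eqSS (gtn_eqF jk) /=.
    case: eqP => [->|_]; last by congr enorm; rewrite opprD addrACA subrr addr0.
    apply: eq_enorm; rewrite /dot !mxE /=.
    transitivity ((D t 0 0 - f t) * (D t 0 0 - f t) + (D t 0 1 - g t) * (D t 0 1 - g t)).
      by rewrite /D !mxE; ring.
    by rewrite fg2 /D d0 /b !mxE; ring.
  + rewrite kj eqxx. apply: eq_enorm.
    rewrite /dot !mxE /=; transitivity (f t * f t + g t * g t); first by ring.
    by rewrite fg1 /b !mxE.
- move=> k c; case: (leqP k j) => kj; first exact: smooth_on_cst.
  case: eqP => _; last first.
    rewrite (_ : (fun t => _) = (fun t => v k 0 c + d t 0 c)); last first.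
      by apply/funext => t; rewrite !mxE.
    by apply: smooth_onD; [exact: smooth_on_cst|exact: smooth_onW (dS c)].
  apply: smooth_on_coord.
    rewrite (_ : (fun t => _) = (fun t => v j 0 0 + f t)); last first.
      by apply/funext => t; rewrite !mxE.
    by apply: smooth_onD => //; exact: smooth_on_cst.
  rewrite (_ : (fun t => _) = (fun t => v j 0 1 + g t)); last first.
    by apply/funext => t; rewrite !mxE.
  by apply: smooth_onD => //; exact: smooth_on_cst.
Qed.

(** The rotation by the angle [t], with both coordinates in the form handled by [smooth_on_trig]. *)
Definition rot2 (t : R) (u : 'rV[R]_2) : 'rV[R]_2 :=
  vec2 (u 0 0 * cos t + - u 0 1 * sin t) (u 0 1 * cos t + u 0 0 * sin t).

Lemma rot2_0 u : rot2 0 u = u.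
Proof.
by apply: row2P; rewrite !mxE /= cos0 sin0 mulr1 mulr0 addr0.
Qed.

Lemma rot2B t u u' : rot2 t u - rot2 t u' = rot2 t (u - u').
Proof. by apply: row2P; rewrite !mxE /=; ring. Qed.

Lemma enorm_rot2 t u : enorm (rot2 t u) = enorm u.
Proof.
apply: eq_enorm; rewrite /dot !mxE /=.
transitivity ((cos t ^+ 2 + sin t ^+ 2) * (u 0 0 * u 0 0 + u 0 1 * u 0 1)); first by ring.
by rewrite cos2Dsin2 mul1r.
Qed.

Lemma smooth_on_rot2 e a u c : smooth_on e (fun t => (a + rot2 t u) 0 c).
Proof.
move: c; apply: smooth_on_coord.
  rewrite (_ : (fun t => _) = (fun t => a 0 0 + (u 0 0 * cos t + - u 0 1 * sin t))).
    by apply: smooth_onD; [exact: smooth_on_cst|exact: smooth_on_trig].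
  by apply/funext => t; rewrite !mxE.
rewrite (_ : (fun t => _) = (fun t => a 0 1 + (u 0 1 * cos t + u 0 0 * sin t))).
  by apply: smooth_onD; [exact: smooth_on_cst|exact: smooth_on_trig].
by apply/funext => t; rewrite !mxE.
Qed.

(** A rigid rotation about the foot needs no bend, so it also serves for an aligned leg. *)
Lemma rotate_leg e p v :
  leg_motion e p v (fun t => v 0%N + rot2 t (v p - v 0%N))
    (fun t k => v 0%N + rot2 t (v k - v 0%N)).
Proof.
split=> // [k _|t|t _ k _|k c].
- by rewrite rot2_0 addrC subrK.
- by rewrite subrr; apply: row2P; rewrite !mxE /= !(mul0r, oppr0, addr0).
- by rewrite opprD addrACA subrr add0r rot2B enorm_rot2 opprB addrA subrK.
- exact: smooth_on_rot2.
Qed.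

End LegMotion.

(** * Curves in the spider space *)

Section Spider.
Variables (R : realType) (n : nat) (M : mechanism R n).
Implicit Types (xi : config M) (i : 'I_n) (g : R -> config M).

Lemma joint_vertex xi i (k : 'I_(nlinks M i).-1) : joint xi k = vertex xi i k.+1.
Proof. by rewrite /vertex valK. Qed.

Lemma vertex_body xi i j : (nlinks M i <= j)%N -> vertex xi i j = body xi.
Proof.
case: j => [|j]; first by rewrite leqn0 => /eqP p0; have := nlinks_gt1 M i; rewrite p0.
by move=> pj; rewrite /vertex insubF // ltnNge -ltnS prednK ?pj // ltnW // nlinks_gt1.
Qed.

Lemma nlinks_gt0 i : (0 < nlinks M i)%N.
Proof. exact: ltnW (nlinks_gt1 M i). Qed.

Lemma config_eq xi xi' : body xi = body xi' ->
  (forall i k, joint xi (i := i) k = joint xi' k) -> xi = xi'.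
Proof.
case: xi xi' => [b J] [b' J'] /= -> JJ'; congr Config.
by apply: functional_extensionality_dep => i; apply/funext => k; exact: JJ'.
Qed.

Lemma spider_edge xi i j : spider_space xi -> (j < nlinks M i)%N ->
  vertex xi i j.+1 - vertex xi i j != 0.
Proof.
move=> xiS jp; apply/eqP => e0; have := link_length_gt0 (Ordinal jp).
by rewrite -(xiS i (Ordinal jp)) /= e0 enorm0 ltxx.
Qed.

(** Legs interact only through the body, so motions built separately over one body curve glue to a
    curve in the spider space on the smallest of the finitely many intervals. *)
Lemma leg_motions_curve xi (X : R -> 'rV[R]_2) (e : R) :
    spider_space xi -> 0 < e -> (forall c, smooth_on e (fun t => X t 0 c)) ->
    X 0 = body xi ->
    (forall i, exists2 e', 0 < e' <= e &
       exists w, leg_motion e' (nlinks M i) (vertex xi i) X w) ->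
  exists2 g, smooth_curve_through xi g & forall t, body (g t) = X t.
Proof.
move=> xiS e0 XS X0 legs.
have /choice[r rP] : forall i, exists r, 0 < r <= e /\
    exists w, leg_motion r (nlinks M i) (vertex xi i) X w.
  by move=> i; have [r re w] := legs i; exists r.
have /choice[w wP] : forall i, exists w, leg_motion (r i) (nlinks M i) (vertex xi i) X w.
  by move=> i; have [_] := rP i.
(* Starting the minimum at [e] keeps [d] at most [e] even when there are no legs. *)
pose d := \big[Num.min/e]_i r i.
have d0 : 0 < d.
  apply: (big_ind (fun x => 0 < x)) => // [x y x0 y0|i _]; first by rewrite lt_min x0.
  by case: (rP i) => /andP[].
have {}wP i : leg_motion d (nlinks M i) (vertex xi i) X (w i).
  by apply: leg_motionW (wP i); exact: bigmin_le.
have dS c : smooth_on d (fun t => X t 0 c).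
  by apply: smooth_onW (XS c); exact: bigmin_le_id.
pose g t := @Config _ _ M (X t) (fun i k => w i t k.+1).
have gE t i j : (j <= nlinks M i)%N -> vertex (g t) i j = w i t j.
  have [_ wf wb _ _] := wP i.
  case: j => [|j] jp; first by rewrite wf.
  have [jp'|] := ltnP j (nlinks M i).-1.
    by rewrite -[j]/(val (Ordinal jp')) -joint_vertex.
  move=> pj; have -> : j.+1 = nlinks M i.
    by apply/eqP; rewrite eqn_leq jp -(prednK (nlinks_gt0 i)) ltnS.
  by rewrite vertex_body // wb.
exists g => //; split.
  apply: config_eq => //= i k; have [w0 _ _ _ _] := wP i.
  rewrite w0 ?joint_vertex //.
  by rewrite -[X in (_ <= X)%N](prednK (nlinks_gt0 i)) ltnS ltnW.
exists d => //; split => //.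
  move=> t td i j; have [_ _ _ wl _] := wP i.
  by rewrite !gE ?(ltnW (ltn_ord j)) // wl // (xiS i j).
by move=> i j c; have [_ _ _ _ wS] := wP i; exact: wS.
Qed.

(** By [straight_leg], a leg without a bend would lie on the line of its first link. *)
Lemma nonaligned_fold xi i : spider_space xi -> ~ aligned xi i ->
  exists2 j, (j.+1 < nlinks M i)%N &
    cross (vertex xi i j.+1 - vertex xi i j)
          (vertex xi i j.+2 - vertex xi i j.+1) != 0.
Proof.
move=> xiS nal; apply: contrapT => nfold; apply: nal.
set v := vertex xi i.
have v_neq0 j : (j < nlinks M i)%N -> v j.+1 - v j != 0 by exact: spider_edge.
exists [set v 0%N + t *: (v 1%N - v 0%N) | t in [set: R]]; split.
  by exists (v 0%N), (v 1%N - v 0%N); split => //; apply: v_neq0; exact: nlinks_gt0.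
move=> j jp.
have [|a vjE] := straight_leg (nlinks_gt0 i) v_neq0 _ jp; last by exists a; last exact: esym.
move=> k kp; apply/eqP/negP => /negP fold; by apply: nfold; exists k.
Qed.

(** * Velocities along curves in the spider space *)

Lemma is_derive_dot (f : R -> 'rV[R]_2) (f' : 'rV[R]_2) (t : R) :
    (forall c, is_derive t 1 (fun s => f s 0 c) (f' 0 c)) ->
  is_derive t 1 (fun s => dot (f s) (f s)) (2 * dot (f t) f').
Proof.
move=> Df; have D c := is_deriveM (Df c) (Df c).
apply: is_derive_eq (is_deriveD (D 0) (D 1)) _.
by rewrite /dot /GRing.scale /=; ring.
Qed.

Lemma is_derive_sq_dist (Z : 'rV[R]_2) g (V : 'rV[R]_2) :
    (forall c, is_derive (0 : R) (1 : R) (fun t => body (g t) 0 c) (V 0 c)) ->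
  is_derive (0 : R) (1 : R) (sq_dist_to Z \o g) (2 * dot (body (g 0) - Z) V).
Proof.
move=> DV; rewrite (_ : _ \o g = fun t => dot (body (g t) - Z) (body (g t) - Z)).
  apply: (is_derive_dot (f := fun t => body (g t) - Z)) => c.
  rewrite (_ : (fun s => _) = fun t => body (g t) 0 c - Z 0 c); last first.
    by apply/funext => t; rewrite !mxE.
  apply: is_derive_eq (is_deriveB (DV c) (is_derive_cst _ _ _)) _.
  by rewrite subr0.
by apply/funext => t; rewrite /= /sq_dist_to enorm_sqr.
Qed.

Lemma smooth_vertex g (e : R) i j c :
    (forall c, smooth_on e (fun t => body (g t) 0 c)) ->
    (forall i (k : 'I_(nlinks M i).-1) c, smooth_on e (fun t => joint (g t) k 0 c)) ->
  smooth_on e (fun t => vertex (g t) i j 0 c).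
Proof.
move=> bS JS; case: j => [|j]; first exact: smooth_on_cst.
by rewrite /vertex; case: insubP => [k _ _|_]; [exact: JS|exact: bS].
Qed.

(* Every link of an aligned leg is parallel to the leg, so its two ends have the
   same velocity component along the leg; this component vanishes at the foot. *)
Lemma aligned_velocity xi g i (a u V : 'rV[R]_2) :
    smooth_curve_through xi g ->
    leg_on xi i [set a + t *: u | t in [set: R]] ->
    (forall c, is_derive (0 : R) (1 : R) (fun t => body (g t) 0 c) (V 0 c)) ->
  dot u V = 0.
Proof.
move=> [g0 [e e0 [gS bS JS]]] [_ on] DV.
have e00 : `|0 : R| < e by rewrite normr0.
pose W j : 'rV[R]_2 := \row_c derive1 (fun t => vertex (g t) i j 0 c) 0.
have DW j c : is_derive (0 : R) (1 : R) (fun t => vertex (g t) i j 0 c) (W j 0 c).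
  by rewrite mxE; apply: smooth_on_is_derive e00; exact: smooth_vertex.
(* The last vertex is the body, and derivatives are unique. *)
have -> : V = W (nlinks M i).
  apply/rowP => c; have D := DW (nlinks M i) c.
  rewrite -(@derive_val _ _ _ _ _ _ _ D) -(@derive_val _ _ _ _ _ _ _ (DV c)).
  by apply: near_eq_derive; near=> t; rewrite vertex_body.
suff: forall j, (j <= nlinks M i)%N -> dot u (W j) = 0 by apply.
elim=> [_|j IH jp].
  have W0 c : W 0%N 0 c = 0.
    by rewrite -(@derive_val _ _ _ _ _ _ _ (DW 0%N c)) derive_cst.
  by rewrite /dot !W0 !mulr0 addr0.
pose f t := vertex (g t) i j.+1 - vertex (g t) i j.
have Df c : is_derive (0 : R) (1 : R) (fun t => f t 0 c) ((W j.+1 - W j) 0 c).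
  rewrite (_ : (fun s => _) = fun t => vertex (g t) i j.+1 0 c - vertex (g t) i j 0 c).
    by apply: is_derive_eq (is_deriveB (DW j.+1 c) (DW j c)) _; rewrite !mxE.
  by apply/funext => t; rewrite !mxE.
have Dff := is_derive_dot Df.
(* The squared link length is constant near time 0, so the link is orthogonal to the difference of
   the velocities of its ends. *)
have Dcst : is_derive (0 : R) (1 : R) (fun t => dot (f t) (f t)) 0.
  apply: near_eq_is_derive (is_derive_cst (link_length (Ordinal jp) ^+ 2) _ _).
  near=> t; rewrite -enorm_sqr /f; congr (_ ^+ 2); apply/esym.
  by apply: (gS t _ i (Ordinal jp)); near: t; exact: near_norm_lt.
have f'0 : dot (f 0) (W j.+1 - W j) = 0.
  have := @derive_val _ _ _ _ _ _ _ Dff.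
  rewrite (@derive_val _ _ _ _ _ _ _ Dcst) => /esym/eqP.
  by rewrite mulf_eq0 pnatr_eq0 /= => /eqP.
have [b f0] : exists b, f 0 = b *: u.
  have [x _ xE] := on j.+1 jp; have [y _ yE] := on j (ltnW jp).
  by exists (x - y); rewrite /f g0 -xE -yE opprD addrACA subrr add0r scalerBl.
have b0 : b != 0.
  have := spider_edge (gS 0 e00) jp; rewrite -/(f 0) f0.
  by apply: contraNneq => ->; rewrite scale0r.
apply: (mulfI b0); rewrite mulr0 -f'0 f0.
rewrite -[LHS]subr0 -[X in _ - X](mulr0 b) -(IH (ltnW jp)).
by rewrite /dot !mxE; ring.
Unshelve. all: by end_near.
Qed.

Lemma smooth_curve_velocity xi g : smooth_curve_through xi g ->
  exists V : 'rV[R]_2, forall c, is_derive (0 : R) (1 : R) (fun t => body (g t) 0 c) (V 0 c).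
Proof.
move=> [_ [e e0 [_ bS _]]]; exists (\row_c derive1 (fun t => body (g t) 0 c) 0) => c.
by rewrite mxE; apply: smooth_on_is_derive (bS c) _; rewrite normr0.
Qed.

(** The derivative of the squared distance is both 0 and twice this dot product. Criticality enters
    the proof of (1), (2) or (3) only in this form. *)
Lemma critical_velocity (Z : 'rV[R]_2) xi g (V : 'rV[R]_2) :
    critical (sq_dist_to Z) xi -> smooth_curve_through xi g ->
    (forall c, is_derive (0 : R) (1 : R) (fun t => body (g t) 0 c) (V 0 c)) ->
  dot (body xi - Z) V = 0.
Proof.
move=> [_ crit] gP DV; have := is_derive_sq_dist Z DV; have Dcrit := crit g gP.
case: gP => -> _ D; have := @derive_val _ _ _ _ _ _ _ D.
rewrite (@derive_val _ _ _ _ _ _ _ Dcrit) => /esym/eqP.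
by rewrite mulf_eq0 pnatr_eq0 /= => /eqP.
Qed.

(** Both lines pass through the body, so parallel directions would make them equal, which smoothness
    forbids. *)
Lemma aligned_legs_transverse xi i k (a u b v : 'rV[R]_2) :
    smooth_spider_space M -> spider_space xi -> i != k ->
    u != 0 -> v != 0 ->
    leg_on xi i [set a + t *: u | t in [set: R]] ->
    leg_on xi k [set b + t *: v | t in [set: R]] ->
  cross u v != 0.
Proof.
move=> smoothM xiS ik u0 v0 oni onk; apply/eqP => /(cross_eq0_colinear u0)[c vE].
have [nosame _] := smoothM xi xiS; apply: nosame.
exists i, k, [set a + t *: u | t in [set: R]]; split=> //.
case: (oni) (onk) => [Lu oni'] [_ onk']; split=> // j jp.
have [x _ xE] := oni' _ (leqnn _); have [y _ yE] := onk' _ (leqnn _).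
have [z _ <-] := onk' j jp; rewrite vertex_body // in xE; rewrite vertex_body // in yE.
(* The body is both a + x u and b + y v; with v = c u this rewrites the point b + z v over the first
   line. *)
exists (x + (z - y) * c) => //.
have -> : b = a + x *: u - y *: v by rewrite xE -yE addrK.
by rewrite vE !scalerA scalerDl mulrBl scalerBl !addrA; rewrite addrAC.
Qed.

End Spider.

Theorem theorem1 (R : realType) (n : nat) (M : mechanism R n)
    (smoothM : smooth_spider_space M) (Z : 'rV[R]_2)
    (xi : config M) (xiS : spider_space xi)
    (star : forall i : 'I_n, aligned xi i ->
       [/\ foot M i <> body xi, foot M i <> Z & body xi <> Z]) :
  critical (sq_dist_to Z) xi <->
  [\/ body xi = Z,
      exists (i : 'I_n) (L : set 'rV[R]_2), leg_on xi i L /\ L Z |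
      exists i k : 'I_n, [/\ i != k, aligned xi i & aligned xi k]].
Proof.
split=> [crit|cond]; last first.
  (* Sufficiency: each condition makes the dot product of X - Z with the body velocity vanish. *)
  split=> // g gP; have [V DV] := smooth_curve_velocity gP.
  apply: is_derive_eq (is_derive_sq_dist Z DV) _.
  have [-> _] := gP; suff -> : dot (body xi - Z) V = 0 by rewrite mulr0.
  case: cond => [->|[i [L [onL LZ]]]|[i [k [ik ali alk]]]].
  - by rewrite /dot subrr !mxE !mul0r addr0.
  - have [[a [u [_ LE]]] _] := onL; subst L.
    have [_ /(_ _ (leqnn _))] := onL; rewrite vertex_body // => -[x _ <-].
    have [z _ <-] := LZ; rewrite opprD addrACA subrr add0r -scalerBl.
    transitivity ((x - z) * dot u V); first by rewrite /dot !mxE; ring.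
    by rewrite (aligned_velocity gP onL DV) mulr0.
  - have [Li oni] := ali; have [Lk onk] := alk.
    have [[a [u [u0 LiE]]] _] := oni; have [[b [v [v0 LkE]]] _] := onk; subst Li Lk.
    have uv := aligned_legs_transverse smoothM xiS ik u0 v0 oni onk.
    have -> : V = 0.
      exact: orthogonal_basis uv (aligned_velocity gP oni DV) (aligned_velocity gP onk DV).
    by rewrite /dot !mxE !mulr0 addr0.
have [[i ali]|noal] := pselect (exists i, aligned xi i); last first.
  (* No leg is aligned: if X and Z differed, the body could move with velocity X - Z, whose dot
     product with X - Z is positive. *)
  constructor 1; apply/eqP; rewrite -subr_eq0; apply/negPn/negP => XZ.
  pose X t := body xi + t *: (body xi - Z).
  have X0 : X 0 = body xi by rewrite /X scale0r addr0.
  have XE c : (fun t => X t 0 c) = fun t => body xi 0 c + t * (body xi - Z) 0 c.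
    by apply/funext => t; rewrite /X !mxE.
  have XS c : smooth_on 1 (fun t => X t 0 c).
    rewrite XE; apply: smooth_onD; first exact: smooth_on_cst.
    by apply: smooth_onM; [exact: smooth_on_id|exact: smooth_on_cst].
  have [k|g gP gX] := leg_motions_curve xiS ltr01 XS X0.
    have [|j jp fold] := nonaligned_fold xiS (i := k).
      by move=> alk; apply: noal; exists k.
    by apply: fold_leg fold => //; rewrite vertex_body.
  have DV c : is_derive (0 : R) (1 : R) (fun t => body (g t) 0 c) ((body xi - Z) 0 c).
    rewrite (_ : (fun t => _) = (fun t => X t 0 c)); last by apply/funext => t; rewrite gX.
    rewrite XE.
    apply: is_derive_eq (is_deriveD (is_derive_cst _ _ _)
      (is_deriveM (is_derive_id _ _) (is_derive_cst _ _ _))) _.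
    by rewrite scaler0 !add0r /GRing.scale /= mulr1.
  by have := dot_gt0 XZ; rewrite (critical_velocity crit gP DV) ltxx.
have [[k [ik alk]]|unique] := pselect (exists k, i != k /\ aligned xi k).
  by constructor 3; exists i, k.
constructor 2; have [L onL] := ali; exists i, L; split=> //.
(* Only leg i is aligned. By the star condition its foot differs from the body, so the radius [r] is
   nonzero and spans the direction of the leg. *)
have [A_X _ _] := star i ali.
pose r := body xi - foot M i.
have r0 : r != 0 by rewrite subr_eq0; apply/eqP/nesym.
pose X t := foot M i + rot2 t r.
have X0 : X 0 = body xi by rewrite /X rot2_0 addrC subrK.
have XS c : smooth_on 1 (fun t => X t 0 c) by exact: smooth_on_rot2.
have [k|g gP gX] := leg_motions_curve xiS ltr01 XS X0.
  have [<-|/eqP ik] := pselect (i = k).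
    exists 1; first by rewrite ltr01 lexx.
    have := rotate_leg 1 (nlinks M i) (vertex xi i).
    by rewrite (vertex_body xi (leqnn _)); eexists; eassumption.
  have [|j jp fold] := nonaligned_fold xiS (i := k).
    by move=> alk; apply: unique; exists k.
  by apply: fold_leg fold => //; rewrite vertex_body.
(* The initial velocity of the rotation is [r] turned by a right angle; its dot product with X - Z
   is thus [cross r (body xi - Z)]. *)
pose V := vec2 (- r 0 1) (r 0 0).
have DV c : is_derive (0 : R) (1 : R) (fun t => body (g t) 0 c) (V 0 c).
  rewrite (_ : (fun t => _) = (fun t => X t 0 c)); last by apply/funext => t; rewrite gX.
  have Dcs (a b : R) : is_derive (0 : R) 1 (fun t : R => a * cos t + b * sin t) b.
    apply: is_derive_eq (is_deriveD (is_deriveZ a (is_derive_cos 0))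
      (is_deriveZ b (is_derive_sin 0))) _.
    by rewrite sin0 cos0 oppr0 scaler0 add0r /GRing.scale /= mulr1.
  move: c => [[|[|//]] lt_c2].
    rewrite (_ : Ordinal _ = 0); last exact: val_inj.
    rewrite (_ : (fun t => _) = (fun t => foot M i 0 0 + (r 0 0 * cos t + - r 0 1 * sin t))).
      rewrite vec2_0; apply: is_derive_eq (is_deriveD (is_derive_cst _ _ _) (Dcs _ _)) _.
      by rewrite add0r.
    by apply/funext => t; rewrite /X !mxE.
  rewrite (_ : Ordinal _ = 1); last exact: val_inj.
  rewrite (_ : (fun t => _) = (fun t => foot M i 0 1 + (r 0 1 * cos t + r 0 0 * sin t))).
    rewrite vec2_1; apply: is_derive_eq (is_deriveD (is_derive_cst _ _ _) (Dcs _ _)) _.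
    by rewrite add0r.
  by apply/funext => t; rewrite /X !mxE.
have : cross r (body xi - Z) = 0.
  rewrite -(critical_velocity crit gP DV) /cross /dot vec2_0 vec2_1; ring.
move=> /(cross_eq0_colinear r0)[b XZ].
have [[a [u [_ LE]]] on] := onL; rewrite LE in on *.
have [x _] := on _ (leqnn _); rewrite vertex_body // => xE.
have [y _] := on 0%N (leq0n _) => /= yE.
(* With body a + x u, foot a + y u and X - Z = b r, the point Z is a + (x - b (x - y)) u. *)
exists (x - b * (x - y)) => //.
rewrite -[Z](subKr (body xi)) XZ /r -xE -yE opprD addrACA subrr add0r -scalerBl scalerA.
by rewrite scalerBl addrA.
Qed.
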